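(* Let $f:[0,1]\to\mathbb{E}^1$ be a continuous fuzzy-valued function. Then, for all positive integers $n$ and all $0<\delta<\frac{1}{2n}$, $$D\left(f,T_{n,\delta}^{f}\right)\le 3\,\omega^{\mathcal F}\left(f,\frac1n\right),$$ where $T_{n,\delta}^f(x):=\sum_{k=0}^n\phi_k(x)\cdot f\left(\frac{k}{n}\right)$ for $x\in[0,1]$, and $\phi_0,\dots,\phi_n:[0,1]\to[0,1]$ are the functions (depending on $n$ and $\delta$) defined in the context.
   Context: Fuzzy numbers. $\mathbb{E}^1$ is the set of functions $u:\mathbb{R}\to[0,1]$ that are normal ($u(x_0)=1$ for some $x_0\in\mathbb{R}$), convex ($u(\lambda x+(1-\lambda)y)\ge\min\{u(x),u(y)\}$ for all $x,y\in\mathbb{R}$, $\lambda\in[0,1]$), upper semicontinuous, and such that $[u]_0:=\overline{\{x\in\mathbb{R}:u(x)>0\}}$ is compact. For $\alpha\in(0,1]$ put $[u]_\alpha:=\{x\in\mathbb{R}:u(x)\ge\alpha\}$. Each $[u]_\alpha$, $\alpha\in[0,1]$, is a compact interval, written $[u_\alpha^-,u_\alpha^+]$. Addition and multiplication by a scalar $k\in\mathbb{R}$ in $\mathbb{E}^1$ are defined level-wise: $[u+v]_\alpha=[u]_\alpha+[v]_\alpha$ (Minkowski sum), $[ku]_\alpha=k[u]_\alpha$. Metric. $d_\infty(u,v):=\sup_{\alpha\in[0,1]}\max\{|u_\alpha^--v_\alpha^-|,|u_\alpha^+-v_\alpha^+|\}$. Continuity of functions $[0,1]\to\mathbb{E}^1$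 is with respect to $d_\infty$, and $D(f,g):=\sup_{x\in[0,1]}d_\infty(f(x),g(x))$. Modulus of continuity. $\omega^{\mathcal F}(f,\delta):=\sup\{d_\infty(f(x),f(y)): x,y\in[0,1],\ |x-y|<\delta\}$. The functions $\phi_k$. Given a positive integer $n$ and $0<\delta<\frac1{2n}$, put $a_j=\frac jn$ for $j=0,\dots,n$. Define $f_0(x)=\frac1\delta(\delta-x)$ if $0\le x<\delta$ and $f_0(x)=0$ if $\delta\le x\le1$. For $1\le j\le n-1$, define $f_j(x)=1$ if $0\le x\le a_j-\delta$, $f_j(x)=\frac1{2\delta}(a_j+\delta-x)$ if $a_j-\delta<x<a_j+\delta$, and $f_j(x)=0$ if $a_j+\delta\le x\le 1$. Then set $\phi_0:=f_0$, $\phi_k:=(1-f_0)(1-f_1)\cdots(1-f_{k-1})f_k$ for $1\le k\le n-1$, and $\phi_n:=(1-f_0)(1-f_1)\cdots(1-f_{n-1})$. *)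

(* Defs.v *)
From HB Require Import structures.
From mathcomp Require Import all_boot all_order all_algebra.
From mathcomp Require Import ring lra.
From mathcomp Require Import all_classical all_reals all_analysis.

Set Implicit Arguments.
Unset Strict Implicit.
Unset Printing Implicit Defensive.

Import Order.TTheory GRing.Theory Num.Theory.
Import numFieldNormedType.Exports.

Local Open Scope classical_set_scope.
Local Open Scope ring_scope.

Section fuzzy_numbers.
Context {R : realType}.
Implicit Types (u v : R -> R) (a b e x y k : R).

Definition level u a : set R :=
  if a == 0 then closure [set x | 0 < u x] else [set x | a <= u x].

Record is_fuzzy u : Prop := IsFuzzy {
  fuzzy_range : forall x, 0 <= u x <= 1 ;
  fuzzy_normal : exists x0, u x0 = 1 ;
  fuzzy_convex : forall x y t, 0 <= t <= 1 ->
    Num.min (u x) (u y) <= u (t * x + (1 - t) * y) ;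
  fuzzy_usc : forall x a, u x < a -> \forall y \near x, u y < a ;
  fuzzy_supp : compact (level u 0) }.

Definition lo u a : R := inf (level u a).
Definition hi u a : R := sup (level u a).

(* The function whose [a]-level sets are [L a], for a family [L] of sets that
   satisfies the hypotheses of [of_levelsP] below. *)
Definition of_levels (L : R -> set R) : R -> R :=
  fun x => sup [set a | a \in `[0, 1] /\ L a x].

Lemma cpt_interval (A : set R) : compact A -> A !=set0 -> is_interval A ->
  A = `[inf A, sup A]%classic.
Proof.
move=> cA A0 iA.
have clA : closed A by apply: compact_closed => //; exact: Rhausdorff.
have [M [Mr Mb]] := compact_bounded cA.
have bA x : A x -> `|x| <= M + 1 by move=> Ax; apply: (Mb (M + 1)) => //; lra.
have hu : has_ubound A.
  by exists (M + 1) => x /bA; rewrite ler_norml => /andP[].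
have hl : has_lbound A.
  by exists (- (M + 1)) => x /bA; rewrite ler_norml => /andP[].
have sA : A (sup A) by apply: clA; exact: closure_sup.
have iA' : A (inf A).
  apply: clA => U /nbhs_ballP[e /= e0 eU].
  have [x Ax xe] := inf_adherent e0 (conj A0 hl).
  have lx : inf A <= x by exact: ge_inf.
  by exists x; split => //; apply: eU; rewrite /ball /= ltr_norml; lra.
apply/seteqP; split=> x /=.
  move=> Ax; rewrite in_itv /=; apply/andP; split.
    exact: ge_inf.
  exact: ub_le_sup.
by rewrite in_itv /= => xx; exact: (iA _ _ iA' sA x xx).
Qed.

Lemma level_gt0 u a : 0 < a -> level u a = [set x | a <= u x].
Proof. by move=> a0; rewrite /level gt_eqF. Qed.

Lemma level0 u : level u 0 = closure [set x | 0 < u x].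
Proof. by rewrite /level eqxx. Qed.

Section levels_of_fuzzy.
Variables (u : R -> R) (fu : is_fuzzy u).

Lemma convex_itv x y z a : a <= u x -> a <= u y -> x <= z <= y -> a <= u z.
Proof.
move=> ax ay /andP[xz zy].
have [xy|xy] := eqVneq x y.
  by have -> : z = x by apply/eqP; rewrite eq_le xz xy zy.
have lxy : x < y by rewrite lt_neqAle xy (le_trans xz).
have yx0 : 0 < y - x by rewrite subr_gt0.
have := fuzzy_convex fu x y (t := (y - z) / (y - x)).
have -> : (y - z) / (y - x) * x + (1 - (y - z) / (y - x)) * y = z.
  by field; lra.
move=> H; apply: le_trans (H _); first by rewrite le_min ax ay.
by rewrite divr_ge0 ?ler_pdivrMr //=; lra.
Qed.

Lemma level_sub a b : 0 <= a -> a <= b -> level u b `<=` level u a.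
Proof.
move=> a0 ab; have [->//|nab] := eqVneq a b.
have {nab} ab' : a < b by rewrite lt_neqAle nab.
have b0 : 0 < b by rewrite (le_lt_trans a0).
rewrite (level_gt0 _ b0); have [->|a0'] := eqVneq a 0.
  rewrite level0 => x /= bx; apply: subset_closure => /=.
  exact: lt_le_trans bx.
rewrite level_gt0; last by rewrite lt_neqAle eq_sym a0'.
by move=> x /=; apply: le_trans.
Qed.

Lemma level_compact a : 0 <= a -> compact (level u a).
Proof.
move=> a0; have [->|a0'] := eqVneq a 0; first exact: fuzzy_supp fu.
have {}a0' : 0 < a by rewrite lt_neqAle eq_sym a0'.
apply: (@subclosed_compact _ _ (level u 0)) => //.
- rewrite level_gt0 // -[X in closed X]setCK; apply: open_closedC.
  rewrite openE => x /= /negP; rewrite -ltNge => /(fuzzy_usc fu) H.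
  near=> y; apply/negP; rewrite -ltNge; near: y; exact: H.
- exact: fuzzy_supp fu.
- exact: level_sub.
Unshelve. all: by end_near. Qed.

Lemma level_neq0 a : 0 <= a <= 1 -> level u a !=set0.
Proof.
case/andP=> a0 a1; have [x ux] := fuzzy_normal fu.
by exists x; apply: (level_sub a0 a1); rewrite level_gt0 //= ux.
Qed.

Lemma level_interval a : 0 <= a -> is_interval (level u a).
Proof.
move=> a0; have [->|a0'] := eqVneq a 0.
  rewrite level0; apply/connected_intervalP/connected_closure.
  apply/connected_intervalP => x y /= x0 y0 z xzy.
  apply: (@lt_le_trans _ _ (Num.min (u x) (u y))).
    by rewrite lt_min x0.
  by apply: convex_itv xzy; rewrite ge_min lexx ?orbT.
rewrite level_gt0; last by rewrite lt_neqAle eq_sym a0'.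
by move=> x y /= ax ay z xzy; exact: convex_itv xzy.
Qed.

Lemma levelE a : 0 <= a <= 1 -> level u a = `[lo u a, hi u a]%classic.
Proof.
move=> a01; have /andP[a0 a1] := a01.
apply: cpt_interval.
- exact: level_compact.
- exact: level_neq0.
- exact: level_interval.
Qed.

Lemma lo_le_hi a : 0 <= a <= 1 -> lo u a <= hi u a.
Proof.
move=> a01; have [x] := level_neq0 a01; rewrite levelE //= in_itv /=.
by case/andP; exact: le_trans.
Qed.

Lemma lo_level a : 0 <= a <= 1 -> level u a (lo u a).
Proof. by move=> a01; rewrite levelE //= in_itv /= lexx lo_le_hi. Qed.

Lemma hi_level a : 0 <= a <= 1 -> level u a (hi u a).
Proof. by move=> a01; rewrite levelE //= in_itv /= lexx lo_le_hi. Qed.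

Lemma lohi_homo a b : 0 <= a -> a <= b -> b <= 1 ->
  lo u a <= lo u b /\ hi u b <= hi u a.
Proof.
move=> a0 ab b1; have b01 : 0 <= b <= 1 by lra.
have a01 : 0 <= a <= 1 by lra.
have := level_sub a0 ab (lo_level b01); have := level_sub a0 ab (hi_level b01).
by rewrite levelE //= !in_itv /=; lra.
Qed.

Lemma lohi_left a e : 0 < a <= 1 -> 0 < e ->
  exists b, [/\ 0 <= b, b < a, lo u a - e <= lo u b & hi u b <= hi u a + e].
Proof.
move=> a01 e0; have a0 : 0 < a by lra.
have a01' : 0 <= a <= 1 by lra.
have lN : u (lo u a - e) < a.
  rewrite ltNge; apply/negP => H.
  have : level u a (lo u a - e) by rewrite level_gt0.
  by rewrite levelE //= in_itv /=; lra.
have hN : u (hi u a + e) < a.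
  rewrite ltNge; apply/negP => H.
  have : level u a (hi u a + e) by rewrite level_gt0.
  by rewrite levelE //= in_itv /=; lra.
pose m := Num.max (u (lo u a - e)) (u (hi u a + e)).
have ma : m < a by rewrite gt_max lN.
have lm : u (lo u a - e) <= m by rewrite le_max lexx.
have hm : u (hi u a + e) <= m by rewrite le_max lexx orbT.
have m0 : 0 <= m.
  by apply: le_trans lm; have /andP[] := fuzzy_range fu (lo u a - e).
pose b := (m + a) / 2.
have b0 : 0 < b by rewrite /b; lra.
have b01 : 0 <= b <= 1 by rewrite /b; lra.
have ba : b < a by rewrite /b; lra.
have mb : m < b by rewrite /b; lra.
have Hl := level_sub (ltW b0) (ltW ba) (lo_level a01').
have Hh := level_sub (ltW b0) (ltW ba) (hi_level a01').
rewrite levelE //= !in_itv /= in Hl Hh.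
exists b; split => //; first exact: ltW.
- rewrite leNgt; apply/negP => H.
  have : level u b (lo u a - e) by rewrite levelE //= in_itv /=; lra.
  by rewrite level_gt0 //= => ?; lra.
- rewrite leNgt; apply/negP => H.
  have : level u b (hi u a + e) by rewrite levelE //= in_itv /=; lra.
  by rewrite level_gt0 //= => ?; lra.
Qed.

Lemma lohi_right0 e : 0 < e ->
  exists a, [/\ 0 < a, a <= 1, lo u a <= lo u 0 + e & hi u 0 - e <= hi u a].
Proof.
move=> e0; have z01 : 0 <= (0 : R) <= 1 by lra.
have : closure [set x | 0 < u x] (lo u 0) by rewrite -level0; exact: lo_level.
have : closure [set x | 0 < u x] (hi u 0) by rewrite -level0; exact: hi_level.
move=> /(_ _ (nbhsx_ballx _ e e0)) [y /= [y0]].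
rewrite /ball /= ltr_norml => yb.
move=> /(_ _ (nbhsx_ballx _ e e0)) [x /= [x0]].
rewrite /ball /= ltr_norml => xb.
pose a := Num.min (u x) (u y).
have a0 : 0 < a by rewrite lt_min x0.
have ax : a <= u x by rewrite ge_min lexx.
have ay : a <= u y by rewrite ge_min lexx orbT.
have a1 : a <= 1 by apply: le_trans ax _; have /andP[] := fuzzy_range fu x.
have a01 : 0 <= a <= 1 by lra.
have lx : level u a x by rewrite level_gt0.
have ly : level u a y by rewrite level_gt0.
rewrite levelE //= !in_itv /= in lx ly.
by exists a; split => //; lra.
Qed.

End levels_of_fuzzy.

Lemma lohi_ext u v : is_fuzzy u -> is_fuzzy v ->
  (forall a, 0 <= a <= 1 -> lo u a = lo v a /\ hi u a = hi v a) -> u = v.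
Proof.
move=> fu fv H; apply/funext => x.
have aux w w' : is_fuzzy w -> is_fuzzy w' ->
    (forall a, 0 <= a <= 1 -> lo w a = lo w' a /\ hi w a = hi w' a) ->
    w x <= w' x.
  move=> fw fw' E; have /andP[w0 w1] := fuzzy_range fw x.
  have /andP[w0' _] := fuzzy_range fw' x.
  have [->//|wn] := eqVneq (w x) 0.
  have w0n : 0 < w x by rewrite lt_neqAle eq_sym wn.
  have w01 : 0 <= w x <= 1 by rewrite w0.
  have : level w (w x) x by rewrite level_gt0 /=.
  rewrite levelE //; have [-> ->] := E _ w01.
  by rewrite -levelE // level_gt0.
apply/eqP; rewrite eq_le !aux //.
by move=> a /H[-> ->].
Qed.

Lemma of_levelsP (L : R -> set R) (l h : R -> R) :
  (forall a b, 0 <= a -> a <= b -> b <= 1 -> l a <= l b /\ h b <= h a) ->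
  l 1 <= h 1 ->
  (forall a e, 0 < a <= 1 -> 0 < e ->
    exists b, [/\ 0 <= b, b < a, l a - e <= l b & h b <= h a + e]) ->
  (forall e, 0 < e ->
    exists a, [/\ 0 < a, a <= 1, l a <= l 0 + e & h 0 - e <= h a]) ->
  (forall a, 0 <= a <= 1 -> L a = `[l a, h a]%classic) ->
  is_fuzzy (of_levels L) /\
  (forall a, 0 <= a <= 1 -> level (of_levels L) a = L a).
Proof.
move=> H1 H2 H3 H4 HL; set u := of_levels L.
pose S x := [set a | a \in `[0, 1] /\ L a x].
have uE x : u x = sup (S x) by [].
have SP x a : S x a -> 0 <= a <= 1 /\ l a <= x <= h a.
  by move=> [+ +]; rewrite in_itv /= => a01; rewrite HL //= in_itv.
have SI x a : 0 <= a <= 1 -> l a <= x <= h a -> S x a.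
  by move=> a01 lh; split; [rewrite in_itv|rewrite HL //= in_itv].
have Sub x : has_ubound (S x) by exists 1 => a /SP[/andP[]].
have urange x : 0 <= u x <= 1.
  rewrite uE; have [->|/set0P S0] := eqVneq (S x) set0.
    by rewrite sup0 lexx ler01.
  apply/andP; split; last by apply: ge_sup => // a /SP[/andP[]].
  have [a Sa] := S0; apply: le_trans (ub_le_sup (Sub x) Sa).
  by have [/andP[]] := SP _ _ Sa.
have Sne x : 0 < u x -> S x !=set0.
  move=> u0; apply/set0P/eqP => S0.
  by move: u0; rewrite uE S0 sup0 ltxx.
have A x a : 0 < a <= 1 -> (a <= u x) <-> (l a <= x <= h a).
  move=> a01; split; last first.
    by move=> lh; rewrite uE; apply: (ub_le_sup (Sub x)); apply: SI => //; lra.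
  move=> aux.
  have [c Sc] : S x !=set0 by apply: Sne; apply: lt_le_trans aux; lra.
  have K e : 0 < e -> l a - e <= x <= h a + e.
    move=> e0; have [b [b0 ba lb hb]] := H3 _ _ a01 e0.
    have d0 : 0 < u x - b by lra.
    have hS : has_sup (S x) by split => //; exists c.
    have [d Sd] := sup_adherent d0 hS.
    rewrite -uE opprB addrC subrK => bd.
    have [d01 ld] := SP _ _ Sd.
    by have := H1 b d b0 (ltW bd); lra.
  apply/andP; split; apply/ler_addgt0Pr => e /K; lra.
have B : closure [set x | 0 < u x] = `[l 0, h 0]%classic.
  apply/seteqP; split.
    rewrite [X in _ `<=` X](_ : _ = closure `[l 0, h 0]%classic); last first.
      by rewrite -(closure_id _).1 //; exact: itv_closed.
    apply: closureS => x /= /Sne [c /SP[c01 lc]].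
    by rewrite in_itv /=; have := H1 0 c; lra.
  move=> x /=; rewrite in_itv /= => x0 U /nbhs_ballP[e /= e0 eU].
  have e20 : 0 < e / 2 by rewrite divr_gt0.
  have [a [a0 a1 la ha]] := H4 _ e20.
  have lha : l a <= h a by have := H1 a 1; lra.
  suff [y [ly yx]] : exists y, l a <= y <= h a /\ `|x - y| < e.
    exists y; split; last exact: eU.
    have a01 : 0 < a <= 1 by rewrite a0.
    exact: lt_le_trans a0 ((A y a a01).2 ly).
  have [xl|lx] := ltP x (l a).
    by exists (l a); rewrite ltr_norml; lra.
  have [hx|xh] := ltP (h a) x.
    by exists (h a); rewrite ltr_norml; lra.
  by exists x; rewrite subrr normr0; lra.
split.
  split => //.
  - exists (l 1); apply/eqP; rewrite eq_le.
    have /andP[_ ->] := urange (l 1); apply/A; rewrite ?lexx ?ltr01 //.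
  - move=> x y t t01; set m := Num.min _ _.
    have mx : m <= u x by rewrite ge_min lexx.
    have my : m <= u y by rewrite ge_min lexx orbT.
    have [m0|m0] := leP m 0.
      by apply: le_trans m0 _; have /andP[] := urange (t * x + (1 - t) * y).
    have m01 : 0 < m <= 1.
      by rewrite m0 (le_trans mx)//; have /andP[] := urange x.
    move/A : mx => /(_ m01) mx; move/A : my => /(_ m01) my.
    by apply/A => //; nra.
  - move=> x a uxa; have [a1|a1] := ltP 1 a.
      by near=> y; apply: le_lt_trans a1; have /andP[] := urange y.
    have a01 : 0 < a <= 1 by rewrite a1 andbT (le_lt_trans _ uxa)//; have /andP[] := urange x.
    have N : nbhs x (~` [set` `[l a, h a]]).
      apply: open_nbhs_nbhs; split; first by apply: closed_openC; exact: itv_closed.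
      by rewrite /= in_itv /= => H; move: uxa; rewrite ltNge ((A x a a01).2 H).
    apply: filterS N => y /=; rewrite in_itv /= => H.
    by rewrite ltNge; apply/negP => /(A y a a01).1.
  - by rewrite level0 B; exact: segment_compact.
move=> a a01; rewrite HL //; have [->|an] := eqVneq a 0.
  by rewrite level0 B.
have a0 : 0 < a by lra.
rewrite level_gt0 //; apply/seteqP; split=> x /=; rewrite in_itv /=.
  by move/A; apply; lra.
by move=> H; apply/A => //; lra.
Unshelve. all: by end_near. Qed.

End fuzzy_numbers.

Record fuzzy (R : realType) := Fuzzy {
  membership :> R -> R ;
  membershipP : is_fuzzy membership }.

HB.instance Definition _ (R : realType) := gen_eqMixin (fuzzy R).
HB.instance Definition _ (R : realType) := gen_choiceMixin (fuzzy R).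

Section fuzzy_operations.
Context {R : realType}.
Implicit Types (u v w : fuzzy R) (a b e x y k : R).

Lemma fuzzy_ext u v :
  (forall a, 0 <= a <= 1 -> lo u a = lo v a /\ hi u a = hi v a) -> u = v.
Proof.
case: u v => [u fu] [v fv] /= H; have E := lohi_ext fu fv H.
by move: fu fv H; rewrite E => fu fv _; congr Fuzzy; exact: Prop_irrelevance.
Qed.

Lemma addset_itv (l h l' h' : R) : l <= h -> l' <= h' ->
  [set x + y | x in `[l, h] & y in `[l', h']] = `[l + l', h + h']%classic.
Proof.
move=> lh lh'; apply/seteqP; split=> z /=; rewrite ?in_itv /=.
  move=> [x]; rewrite /= in_itv /= => xx [y]; rewrite /= in_itv /= => yy <-.
  by lra.
move=> zz; have [zl|lz] := ltP (z - l') h.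
  exists (z - l'); first by rewrite /= in_itv /=; lra.
  by exists l'; [rewrite /= in_itv /=; lra|lra].
exists h; first by rewrite /= in_itv /=; lra.
by exists (z - h); [rewrite /= in_itv /=; lra|lra].
Qed.

Lemma scaleset_itv k (l h : R) : l <= h ->
  [set k * x | x in `[l, h]] =
  `[Num.min (k * l) (k * h), Num.max (k * l) (k * h)]%classic.
Proof.
move=> lh; apply/seteqP; split=> z /=; rewrite ?in_itv /=.
  move=> [x]; rewrite /= in_itv /= => /andP[lx xh] <-.
  rewrite ge_min le_max; have [k0|k0] := leP 0 k.
    by apply/andP; split; apply/orP; [left|right]; exact: ler_wpM2l.
  by apply/andP; split; apply/orP; [right|left]; apply: ler_wnM2l => //; exact: ltW.
have [->|kn] := eqVneq k 0.
  rewrite !mul0r minxx maxxx -eq_le => /eqP z0.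
  by exists l; [rewrite /= in_itv /= lexx|rewrite mul0r].
have kz : k * (z / k) = z by field.
rewrite -{1 2}kz ge_min le_max => H; exists (z / k) => //.
rewrite /= in_itv /=; move: H; move: (z / k) => t.
have [k0|k0] := leP 0 k.
  have {}k0 : 0 < k by rewrite lt_neqAle eq_sym kn.
  by rewrite !ler_pM2l //; lra.
by rewrite !ler_nM2l //; lra.
Qed.

Definition add_levels u v a : set R :=
  [set x + y | x in level u a & y in level v a].

Lemma add_of_levelsP u v :
  is_fuzzy (of_levels (add_levels u v)) /\
  (forall a, 0 <= a <= 1 ->
     level (of_levels (add_levels u v)) a = add_levels u v a).
Proof.
have fu := membershipP u; have fv := membershipP v.
apply: (@of_levelsP _ _ (fun a => lo u a + lo v a) (fun a => hi u a + hi v a)).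
- move=> a b a0 ab b1; have := lohi_homo fu a0 ab b1.
  by have := lohi_homo fv a0 ab b1; lra.
- have H : 0 <= (1 : R) <= 1 by lra.
  by have := lo_le_hi fu H; have := lo_le_hi fv H; lra.
- move=> a e a01 e0; have e20 : 0 < e / 2 by rewrite divr_gt0.
  have [b [b0 ba bl bh]] := lohi_left fu a01 e20.
  have [c [c0 ca cl ch]] := lohi_left fv a01 e20.
  pose d := Num.max b c.
  have bd : b <= d by rewrite le_max lexx.
  have cd : c <= d by rewrite le_max lexx orbT.
  have da : d < a by rewrite gt_max ba.
  have d1 : d <= 1 by lra.
  have := lohi_homo fu b0 bd d1; have := lohi_homo fv c0 cd d1.
  by exists d; split => //; lra.
- move=> e e0; have e20 : 0 < e / 2 by rewrite divr_gt0.
  have [b [b0 b1 bl bh]] := lohi_right0 fu e20.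
  have [c [c0 c1 cl ch]] := lohi_right0 fv e20.
  pose d := Num.min b c.
  have db : d <= b by rewrite ge_min lexx.
  have dc : d <= c by rewrite ge_min lexx orbT.
  have d0 : 0 < d by rewrite lt_min b0.
  have := lohi_homo fu (ltW d0) db b1; have := lohi_homo fv (ltW d0) dc c1.
  by exists d; split => //; lra.
- move=> a a01; rewrite /add_levels !levelE ?addset_itv //; exact: lo_le_hi.
Qed.

Definition fadd u v : fuzzy R := Fuzzy (add_of_levelsP u v).1.

Lemma level_add u v a : 0 <= a <= 1 ->
  level (fadd u v) a = [set x + y | x in level u a & y in level v a].
Proof. exact: (add_of_levelsP u v).2. Qed.

Lemma lohi_level u a (l h : R) : l <= h -> level u a = `[l, h]%classic ->
  lo u a = l /\ hi u a = h.
Proof. by move=> lh E; rewrite /lo /hi E inf_itvcc ?sup_itvcc. Qed.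

Lemma lohi_add u v a : 0 <= a <= 1 ->
  lo (fadd u v) a = lo u a + lo v a /\ hi (fadd u v) a = hi u a + hi v a.
Proof.
move=> a01; have fu := membershipP u; have fv := membershipP v.
have lu := lo_le_hi fu a01; have lv := lo_le_hi fv a01.
apply: lohi_level; first lra.
by rewrite level_add // !levelE ?addset_itv.
Qed.

Definition scale_levels k u a : set R := [set k * x | x in level u a].

Lemma scale_of_levelsP k u :
  is_fuzzy (of_levels (scale_levels k u)) /\
  (forall a, 0 <= a <= 1 ->
     level (of_levels (scale_levels k u)) a = scale_levels k u a).
Proof.
have fu := membershipP u.
have kp : 0 < `|k| + 1 by have := normr_ge0 k; lra.
have scale_e e : 0 < e -> 0 < e / (`|k| + 1) /\ `|k| * (e / (`|k| + 1)) <= e.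
  move=> e0; split; first by rewrite divr_gt0.
  rewrite mulrA ler_pdivrMr // mulrC ler_pM2l //; lra.
have I01 : 0 <= (1 : R) <= 1 by lra.
have L1 := lo_le_hi fu I01.
have [k0|k0] := leP 0 k.
  rewrite (ger0_norm k0) in kp scale_e.
  apply: (@of_levelsP _ _ (fun a => k * lo u a) (fun a => k * hi u a)).
  - move=> a b a0 ab b1; have [? ?] := lohi_homo fu a0 ab b1.
    by rewrite !ler_wpM2l.
  - by rewrite ler_wpM2l.
  - move=> a e a01 /scale_e[d0 de]; have [b [b0 ba bl bh]] := lohi_left fu a01 d0.
    by exists b; split => //; nra.
  - move=> e /scale_e[d0 de]; have [b [b0 ba bl bh]] := lohi_right0 fu d0.
    by exists b; split => //; nra.
  - move=> a a01; have L := lo_le_hi fu a01.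
    have kL : k * lo u a <= k * hi u a by rewrite ler_wpM2l.
    by rewrite /scale_levels levelE // scaleset_itv // min_l ?max_r.
rewrite (ltr0_norm k0) in kp scale_e.
apply: (@of_levelsP _ _ (fun a => k * hi u a) (fun a => k * lo u a)).
- move=> a b a0 ab b1; have [? ?] := lohi_homo fu a0 ab b1.
  by rewrite !ler_wnM2l // ltW.
- by rewrite ler_wnM2l // ltW.
- move=> a e a01 /scale_e[d0 de]; have [b [b0 ba bl bh]] := lohi_left fu a01 d0.
  by exists b; split => //; nra.
- move=> e /scale_e[d0 de]; have [b [b0 ba bl bh]] := lohi_right0 fu d0.
  by exists b; split => //; nra.
- move=> a a01; have L := lo_le_hi fu a01.
  have kL : k * hi u a <= k * lo u a by rewrite ler_wnM2l // ltW.
  by rewrite /scale_levels levelE // scaleset_itv // min_r ?max_l.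
Qed.

Definition fscale k u : fuzzy R := Fuzzy (scale_of_levelsP k u).1.

Lemma level_scale k u a : 0 <= a <= 1 ->
  level (fscale k u) a = [set k * x | x in level u a].
Proof. exact: (scale_of_levelsP k u).2. Qed.

Lemma zero_of_levelsP :
  is_fuzzy (of_levels (fun=> [set (0 : R)])) /\
  (forall a, 0 <= a <= 1 -> level (of_levels (fun=> [set (0 : R)])) a = [set 0]).
Proof.
apply: (@of_levelsP _ _ (fun=> 0) (fun=> 0)) => //.
- by move=> a e a01 e0; exists 0; split; lra.
- by move=> e e0; exists 1; split; lra.
- by move=> a _; rewrite set_itv1.
Qed.

Definition fzero : fuzzy R := Fuzzy zero_of_levelsP.1.

Lemma level_zero a : 0 <= a <= 1 -> level fzero a = [set 0].
Proof. exact: zero_of_levelsP.2. Qed.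

Lemma lohi_zero a : 0 <= a <= 1 -> lo fzero a = 0 /\ hi fzero a = 0.
Proof. by move=> a01; apply: lohi_level => //; rewrite level_zero // set_itv1. Qed.

Lemma faddA : associative fadd.
Proof.
move=> u v w; apply: fuzzy_ext => a a01.
by rewrite !(lohi_add _ _ a01).1 !(lohi_add _ _ a01).2 !addrA.
Qed.

Lemma faddC : commutative fadd.
Proof.
move=> u v; apply: fuzzy_ext => a a01.
rewrite !(lohi_add _ _ a01).1 !(lohi_add _ _ a01).2.
by split; exact: addrC.
Qed.

Lemma fadd0 : left_id fzero fadd.
Proof.
move=> u; apply: fuzzy_ext => a a01.
by rewrite !(lohi_add _ _ a01).1 !(lohi_add _ _ a01).2 (lohi_zero a01).1 (lohi_zero a01).2 !add0r.
Qed.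

Definition d_infty u v : R :=
  sup [set Num.max `|lo u a - lo v a| `|hi u a - hi v a| | a in `[0, 1]].

Lemma has_sup_d_infty u v :
  has_sup [set Num.max `|lo u a - lo v a| `|hi u a - hi v a| | a in `[0, 1]].
Proof.
have fu := membershipP u; have fv := membershipP v.
split; first by eexists; exists 0 => //; rewrite /= in_itv /= lexx ler01.
exists (`|lo u 0| + `|lo v 0| + `|hi u 0| + `|hi v 0|) => _ [a + <-].
rewrite /= in_itv /= => a01.
have [a0 a1] := andP a01.
have := lohi_homo fu (lexx 0) a0 a1; have := lohi_homo fv (lexx 0) a0 a1.
have := lo_le_hi fu a01; have := lo_le_hi fv a01.
have := ler_norm (lo u 0); have := ler_norm (- lo u 0).
have := ler_norm (lo v 0); have := ler_norm (- lo v 0).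
have := ler_norm (hi u 0); have := ler_norm (- hi u 0).
have := ler_norm (hi v 0); have := ler_norm (- hi v 0).
rewrite !normrN ge_max !ler_norml.
by move=> *; apply/andP; split; apply/andP; split; lra.
Qed.

Lemma d_infty_ge u v a : 0 <= a <= 1 ->
  `|lo u a - lo v a| <= d_infty u v /\ `|hi u a - hi v a| <= d_infty u v.
Proof.
move=> a01.
have : Num.max `|lo u a - lo v a| `|hi u a - hi v a| <= d_infty u v.
  apply: ub_le_sup; first exact: (has_sup_d_infty u v).2.
  by exists a => //; rewrite /= in_itv.
by rewrite ge_max => /andP[].
Qed.

Lemma d_infty_le u v (r : R) :
  (forall a, 0 <= a <= 1 ->
    `|lo u a - lo v a| <= r /\ `|hi u a - hi v a| <= r) -> d_infty u v <= r.
Proof.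
move=> H; apply: ge_sup; first exact: (has_sup_d_infty u v).1.
move=> _ [a + <-]; rewrite /= in_itv /= => /H[? ?].
by rewrite ge_max; apply/andP.
Qed.

Lemma d_inftyxx u : d_infty u u = 0.
Proof.
apply/eqP; rewrite eq_le; apply/andP; split.
  by apply: d_infty_le => a _; rewrite !subrr normr0.
have z01 : 0 <= (0 : R) <= 1 by rewrite lexx ler01.
by have [H _] := d_infty_ge u u z01; apply: le_trans H.
Qed.

Lemma d_infty_eq0 u v : d_infty u v = 0 -> u = v.
Proof.
move=> d0; apply: fuzzy_ext => a /(d_infty_ge u v); rewrite d0.
by rewrite !normr_le0 !subr_eq0 => -[/eqP -> /eqP ->].
Qed.

Lemma d_infty_sym u v : d_infty u v = d_infty v u.
Proof.
have aux w z : d_infty w z <= d_infty z w.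
  apply: d_infty_le => a /(d_infty_ge z w).
  by rewrite (distrC (lo z a)) (distrC (hi z a)).
by apply/eqP; rewrite eq_le !aux.
Qed.

Lemma d_infty_triangle v u w : d_infty u w <= d_infty u v + d_infty v w.
Proof.
apply: d_infty_le => a a01.
have [? ?] := d_infty_ge u v a01; have [? ?] := d_infty_ge v w a01.
split; first by apply: le_trans (ler_distD (lo v a) _ _) _; exact: lerD.
by apply: le_trans (ler_distD (hi v a) _ _) _; exact: lerD.
Qed.

End fuzzy_operations.

HB.instance Definition _ (R : realType) :=
  GRing.isNmodule.Build (fuzzy R) faddA faddC fadd0.

HB.instance Definition _ (R : realType) :=
  isMetric.Build R (fuzzy R)
    d_inftyxx d_infty_eq0 d_infty_sym d_infty_triangle.

Section statement_notions.
Context {R : realType}.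
Implicit Types (f g : R -> fuzzy R) (n k : nat) (delta x : R).

(* Functions on [0, 1] are represented by functions on R, of which only the
   values on [0, 1] matter. Both suprema are taken in the extended reals, so
   that no convention for unbounded sets interferes. *)
Definition fuzzy_dist f g : \bar R :=
  ereal_sup [set (d_infty (f x) (g x))%:E | x in `[0, 1]].

Definition fuzzy_modulus f delta : \bar R :=
  ereal_sup [set (d_infty (f p.1) (f p.2))%:E | p in
    [set p : R * R |
      [/\ p.1 \in `[0, 1], p.2 \in `[0, 1] & `|p.1 - p.2| < delta]]].

Definition ramp n delta k x : R :=
  let a : R := k%:R / n%:R in
  if k == 0%N then (if x < delta then delta^-1 * (delta - x) else 0)
  else if x <= a - delta then 1
  else if x < a + delta then (2 * delta)^-1 * (a + delta - x)
  else 0.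

(* There is no ramp of index n: the last factor of phi n is 1. *)
Definition phi n delta k x : R :=
  (\prod_(j < k) (1 - ramp n delta j x)) *
  (if (k < n)%N then ramp n delta k x else 1).

Definition fuzzy_approx n delta f x : fuzzy R :=
  \sum_(k < n.+1) fscale (phi n delta k x) (f (k%:R / n%:R)).

End statement_notions.

(* Main.v *)
(** Since [phi n delta k x <> 0] forces [|x - k/n| < 1/n + delta < 3/(2n)], the
    midpoint of [x] and [k/n] is at distance less than [1/n] from both, so that
    [f (k/n)] lies within twice the modulus of continuity of [f x]. The [phi]'s
    being nonnegative of sum 1, the same bound holds for [fuzzy_approx], because
    balls for [d_infty] are convex. The constant 2 thus suffices in place of 3. *)
Require Import Defs.
From mathcomp Require Import all_boot all_order all_algebra.
From mathcomp Require Import ring lra.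
From mathcomp Require Import all_classical all_reals all_analysis.

Import Order.TTheory GRing.Theory Num.Theory.
Import numFieldNormedType.Exports.

Local Open Scope classical_set_scope.
Local Open Scope ring_scope.

Lemma lohi_scale_ge0 (R : realType) (c : R) (u : fuzzy R) (a : R) :
  0 <= c -> 0 <= a <= 1 ->
  lo (fscale c u) a = c * lo u a /\ hi (fscale c u) a = c * hi u a.
Proof.
move=> c0 a01; have fu := membershipP u; have luh := lo_le_hi fu a01.
have cluh : c * lo u a <= c * hi u a by rewrite ler_wpM2l.
apply: lohi_level => //.
by rewrite level_scale // levelE // scaleset_itv // min_l ?max_r.
Qed.

(** Both endpoints are additive in the fuzzy number, and homogeneous for nonnegative scalars; a
    negative scalar would swap them. *)
Lemma lohi_comb (R : realType) (m : nat) (c : 'I_m -> R) (v : 'I_m -> fuzzy R)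
    (a : R) :
  (forall k, 0 <= c k) -> 0 <= a <= 1 ->
  lo (\sum_k fscale (c k) (v k)) a = \sum_k c k * lo (v k) a /\
  hi (\sum_k fscale (c k) (v k)) a = \sum_k c k * hi (v k) a.
Proof.
move=> c0 a01.
have loD := fun u w : fuzzy R => (lohi_add u w a01).1.
have hiD := fun u w : fuzzy R => (lohi_add u w a01).2.
split.
- rewrite (big_morph (fun u : fuzzy R => lo u a) loD (lohi_zero a01).1).
  by apply: eq_bigr => k _; rewrite (lohi_scale_ge0 _ _ _ _ (c0 k) a01).1.
- rewrite (big_morph (fun u : fuzzy R => hi u a) hiD (lohi_zero a01).2).
  by apply: eq_bigr => k _; rewrite (lohi_scale_ge0 _ _ _ _ (c0 k) a01).2.
Qed.

Lemma dist_convex_comb (R : realType) (m : nat) (c y : 'I_m -> R) (x r : R) :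
  (forall k, 0 <= c k) -> \sum_k c k = 1 ->
  (forall k, c k != 0 -> `|x - y k| <= r) ->
  `|x - \sum_k c k * y k| <= r.
Proof.
(* As the weights sum to 1, [x] and [r] become the sums of [c k * x] and [c k * r], and the claim
   reduces to termwise comparison. *)
move=> c0 c1 H; rewrite -[x]mul1r -[r]mul1r -c1 !mulr_suml -sumrB.
apply: le_trans (ler_norm_sum _ _ _) _; apply: ler_sum => k _.
rewrite -mulrBr normrM (ger0_norm (c0 k)).
by have [->|/H xr] := eqVneq (c k) 0; rewrite ?mul0r // ler_wpM2l.
Qed.

(** At each level, the endpoints of the combination are the same convex combination of the
    endpoints, so the real case applies to each. *)
Lemma d_infty_convex_comb (R : realType) (m : nat) (c : 'I_m -> R)
    (u : fuzzy R) (v : 'I_m -> fuzzy R) (r : R) :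
  (forall k, 0 <= c k) -> \sum_k c k = 1 ->
  (forall k, c k != 0 -> d_infty u (v k) <= r) ->
  d_infty u (\sum_k fscale (c k) (v k)) <= r.
Proof.
move=> c0 c1 H; apply: d_infty_le => a a01.
have [-> ->] := lohi_comb _ _ _ v _ c0 a01.
split; apply: dist_convex_comb => // k /H; apply: le_trans;
  by have [] := d_infty_ge u (v k) a01.
Qed.

Section partition_of_unity.
Context {R : realType}.
Variables (n : nat) (delta x : R).

Lemma ramp_itv k : 0 < delta -> 0 <= x -> 0 <= ramp n delta k x <= 1.
Proof.
move=> delta0 x0.
have quotient_itv (c d : R) : 0 < d -> 0 <= c <= d -> 0 <= d^-1 * c <= 1.
  move=> d0 /andP[c0 cd]; rewrite mulrC ler_pdivrMr // mul1r cd andbT.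
  by rewrite divr_ge0 // ltW.
rewrite /ramp; case: eqP => _.
  case: ltP => xd; last by rewrite lexx ler01.
  by apply: quotient_itv; lra.
case: (leP x (k%:R / n%:R - delta)) => xl; first by rewrite lexx ler01.
case: ltP => xu; last by rewrite lexx ler01.
by apply: quotient_itv; lra.
Qed.

Lemma ramp_neq0 k : 0 < delta ->
  ramp n delta k x != 0 -> x < k%:R / n%:R + delta.
Proof.
move=> delta0; rewrite /ramp; case: (eqVneq k 0%N) => [->|_].
  by rewrite mul0r add0r; case: ltP; rewrite ?eqxx.
case: (leP x (k%:R / n%:R - delta)) => [? _|_]; first lra.
by case: ltP; rewrite ?eqxx.
Qed.

Lemma ramp_neq1 k : 0 < delta -> 0 <= x ->
  1 - ramp n delta k x != 0 -> k%:R / n%:R - delta < x.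
Proof.
move=> delta0 x0; rewrite /ramp; case: (eqVneq k 0%N) => [-> _|_]; first by rewrite mul0r; lra.
by case: (leP x (k%:R / n%:R - delta)); rewrite ?subrr ?eqxx.
Qed.

Lemma phi_ge0 k : 0 < delta -> 0 <= x -> 0 <= phi n delta k x.
Proof.
move=> delta0 x0; rewrite /phi mulr_ge0 //.
  by apply: prodr_ge0 => j _; have := ramp_itv j delta0 x0; lra.
by case: ifP => // _; have := ramp_itv k delta0 x0; lra.
Qed.

(** With P_m the product of [1 - ramp n delta j x] over j < m, phi_m = P_m - P_(m+1) for m < n,
    which telescopes; the last term phi_n = P_n restores 1. *)
Lemma sum_phi : \sum_(k < n.+1) phi n delta k x = 1.
Proof.
suff telescope m : (m <= n)%N -> \sum_(k < m) phi n delta k x =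
    1 - \prod_(j < m) (1 - ramp n delta j x).
  by rewrite big_ord_recr /= telescope // /phi ltnn mulr1 subrK.
elim: m => [|m IHm] mn; first by rewrite !big_ord0 subrr.
by rewrite !big_ord_recr /= IHm ?(ltnW mn) // /phi mn; ring.
Qed.

(** No factor vanishes: [1 - ramp] at index k - 1 bounds [x] from below by (k-1)/n - delta, and
    [ramp] at k bounds it from above by k/n + delta. *)
Lemma phi_neq0 k : (0 < n)%N -> (k <= n)%N -> 0 < delta -> 0 <= x <= 1 ->
  phi n delta k x != 0 -> `|x - k%:R / n%:R| < n%:R^-1 + delta.
Proof.
move=> n0 kn delta0 /andP[x0 x1]; rewrite /phi mulf_eq0 negb_or => /andP[prod_neq0 ramp_k].
have nV0 : 0 < n%:R^-1 :> R by rewrite invr_gt0 ltr0n.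
have lower : k%:R / n%:R - (n%:R^-1 + delta) < x.
  (* For k = 0 the product is empty and [0 <= x] gives the bound. *)
  case: k prod_neq0 {kn ramp_k} => [_|k]; first by rewrite mul0r; lra.
  rewrite big_ord_recr /= mulf_eq0 negb_or => /andP[_ /(ramp_neq1 _ delta0 x0)].
  by rewrite -natr1 mulrDl mul1r; lra.
have upper : x < k%:R / n%:R + (n%:R^-1 + delta).
  move: kn ramp_k; rewrite leq_eqVlt => /predU1P[->|->].
    (* For k = n there is no ramp factor; here k/n = 1 and [x <= 1]. *)
    by rewrite divff ?pnatr_eq0 -?lt0n //; lra.
  by move=> /(ramp_neq0 _ delta0); lra.
by rewrite ltr_norml; lra.
Qed.

End partition_of_unity.

Lemma d_infty_double_modulus (R : realType) (f : R -> fuzzy R) (h r x y : R) :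
  (forall s t, 0 <= s <= 1 -> 0 <= t <= 1 -> `|s - t| < h ->
    d_infty (f s) (f t) <= r) ->
  0 <= x <= 1 -> 0 <= y <= 1 -> `|x - y| < 2 * h ->
  d_infty (f x) (f y) <= 2 * r.
Proof.
move=> H x01 y01; rewrite ltr_norml => xy.
apply: le_trans (d_infty_triangle (f ((x + y) / 2)) _ _) _.
have := H x ((x + y) / 2); have := H ((x + y) / 2) y; rewrite !ltr_norml.
move=> /(_ _ y01) my /(_ x01) xm.
have {}my : d_infty (f ((x + y) / 2)) (f y) <= r by apply: my; lra.
have {}xm : d_infty (f x) (f ((x + y) / 2)) <= r by apply: xm; lra.
lra.
Qed.

Theorem theorem3p12 (R : realType) (f : R -> fuzzy R) (n : nat) (delta : R) :
  {within `[0, 1], continuous f} ->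
  (0 < n)%N ->
  0 < delta < (2 * n%:R)^-1 ->
  (fuzzy_dist f (fuzzy_approx n delta f) <= 3%:E * fuzzy_modulus f n%:R^-1)%E.
Proof.
move=> _ n0 /andP[delta0]; rewrite invfM => delta_lt.
have nV0 : 0 < n%:R^-1 :> R by rewrite invr_gt0 ltr0n.
set w := fuzzy_modulus f n%:R^-1.
have wP s t : 0 <= s <= 1 -> 0 <= t <= 1 -> `|s - t| < n%:R^-1 ->
    ((d_infty (f s) (f t))%:E <= w)%E.
  by move=> s01 t01 st; apply: ereal_sup_ubound; exists (s, t); rewrite //= !in_itv.
(* The pair (0, 0) excludes the value -oo for the supremum. *)
have w0 : (0 <= w)%E.
  have := wP 0 0; rewrite subrr normr0 d_inftyxx lexx ler01.
  exact.
(* If the modulus is +oo, so is the right-hand side; otherwise it is a real [r >= 0], whence 2r <=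
   3r. *)
move: w w0 wP => [r| |] // r0 wP; last by rewrite gt0_muley ?leey // lte_fin.
rewrite lee_fin in r0; rewrite -EFinM.
apply: ge_ereal_sup => _ [x + <-]; rewrite /= in_itv /= => x01.
have /andP[x0 x1] := x01; rewrite lee_fin.
apply: (@le_trans _ _ (2 * r)); last lra.
apply: d_infty_convex_comb; [|exact: sum_phi|] => k; first exact: phi_ge0.
have kn : (k <= n)%N by rewrite -ltnS.
move=> /(phi_neq0 _ _ _ _ n0 kn delta0 x01) xk.
(* [delta < 1/(2n)] makes 1/n + delta less than 2/n. *)
apply: (d_infty_double_modulus _ _ n%:R^-1) => //; last by lra.
by rewrite divr_ge0 ?ler0n //= ler_pdivrMr ?ltr0n // mul1r ler_nat.
Qed.
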